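(* Let $\mathfrak{g}$ be a finite dimensional $p$-step nilpotent Lie algebra over a field $k$ with free $p$-step nilpotent extension $$0\to\mathfrak{n}\to\mathfrak{f}_{n,p}\xrightarrow{\pi}\mathfrak{g}\to0.$$ Then $$\dim_kF_p\mathrm{H}^2(\mathfrak{g},k)=\dim_k\frac{\mathfrak{n}}{[\mathfrak{f}_{n,p},\mathfrak{n}]},$$ $$\dim_k\mathrm{H}^2(\mathfrak{g},k)=\dim_k\frac{\mathfrak{n}}{[\mathfrak{f}_{n,p},\mathfrak{n}]}+b_2(\mathfrak{f}_{n,p})-\dim_k\big([i(\mathfrak{n}),\mathfrak{f}_{n,p+1}]\cap\mathfrak{f}_{n,p+1}^{p+1}\big),$$ where $i:\mathfrak{f}_{n,p}\to\mathfrak{f}_{n,p+1}$ is the canonical vector space inclusion.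
   Context: The field $k$ is arbitrary and is regarded as the trivial $\mathfrak{g}$-module when used as coefficients. $b_2(\mathfrak{h})=\dim_k\mathrm{H}^2(\mathfrak{h},k)$. For subspaces $A,B$ of a Lie algebra, $[A,B]$ is the linear span of all brackets $[a,b]$, $a\in A$, $b\in B$. The lower central series of a Lie algebra $\mathfrak{h}$ is $\mathfrak{h}^1=\mathfrak{h}$, $\mathfrak{h}^{i+1}=[\mathfrak{h},\mathfrak{h}^i]$; $\mathfrak{h}$ is $p$-step nilpotent ($p\ge1$) if $\mathfrak{h}^p\ne0$ and $\mathfrak{h}^{p+1}=0$. Let $\mathfrak{f}_n$ be the free Lie algebra over $k$ on $n$ generators, graded as $\mathfrak{f}_n=H_1(n)\oplus H_2(n)\oplus\cdots$ with $H_i(n)$ the span of Lie monomials of degree $i$ in the generators. $\mathfrak{f}_{n,r}=\mathfrak{f}_n/\mathfrak{f}_n^{r+1}=H_1(n)\oplus\dots\oplus H_r(n)$ is the free $r$-step nilpotent Lie algebra on $n$ generators. The canonical vector space inclusion $i:\mathfrak{f}_{n,p}\to\mathfrak{f}_{n,p+1}$ is the linear map that is the identity on each $H_j(n)$, $1\le j\le p$; it is a linear splitting of the canonical projection $\mathfrak{f}_{n,p+1}\to\mathfrak{f}_{n,p}$. Let $n=\dim_k\mathfrak{g}/[\mathfrak{g},\mathfrak{g}]$. A free $p$-step nilpotent extension of the $p$-step nilpotent Lie algebra $\mathfrak{g}$ is a short exact sequence of Lie algebras $0\to\mathfrak{n}\to\mathfrak{f}_{n,p}\xrightarrow{\pi}\mathfrak{g}\to0$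 with $\mathfrak{n}\subset[\mathfrak{f}_{n,p},\mathfrak{f}_{n,p}]$. For a $\mathfrak{g}$-module $M$ set $M_j=0$ for integers $j\le0$ and $M_i=\{m\in M\mid xm\in M_{i-1}\text{ for all }x\in\mathfrak{g}\}$ for $i\ge1$ (so for $M=k$ trivial, $M_i=k$ for $i\ge1$). $F_r\mathrm{H}^2(\mathfrak{g},M)$ is the subspace of $\mathrm{H}^2(\mathfrak{g},M)$ (Chevalley-Eilenberg cohomology) of classes represented by $2$-cocycles $f$ such that $f(x\wedge y)\in M_{r-i-j+1}$ whenever $x\in\mathfrak{g}^i$, $y\in\mathfrak{g}^j$. *)

(* Defs.v *)
From HB Require Import structures.
From mathcomp Require Import all_boot all_order all_algebra.
From mathcomp Require Import boolp.

Set Implicit Arguments.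
Unset Strict Implicit.
Unset Printing Implicit Defensive.

Import GRing.Theory.
Local Open Scope ring_scope.

Section Span.
Variables (k : fieldType) (V : lmodType k).

Definition lspan (A : V -> Prop) (u : V) : Prop :=
  exists (m : nat) (c : 'I_m -> k) (a : 'I_m -> V),
    (forall j, A (a j)) /\ u = \sum_j c j *: a j.

Definition submodule_pred (P : V -> Prop) : Prop :=
  P 0 /\ forall c u v, P u -> P v -> P (c *: u + v).

Lemma lspan_sub (A P : V -> Prop) :
  submodule_pred P -> (forall u, A u -> P u) -> forall u, lspan A u -> P u.
Proof.
move=> [P0 PD] AP u [m [c [a [Aa ->]]]].
elim/big_rec: _ => // j v _ Pv.
by apply: PD => //; apply: AP.
Qed.

Lemma lspan_gen (A : V -> Prop) u : A u -> lspan A u.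
Proof.
move=> Au; exists 1, (fun=> 1), (fun=> u); split=> //.
by rewrite big_ord1 scale1r.
Qed.

Lemma lspan_submodule (A : V -> Prop) : submodule_pred (lspan A).
Proof.
split.
  by exists 0, (fun=> 0), (fun=> 0); split=> [[]//|]; rewrite big_ord0.
move=> c u v [m [d [a [Aa ->]]]] [m' [d' [a' [Aa' ->]]]].
exists (m + m')%N.
exists (fun j => match split j with inl i => c * d i | inr i => d' i end).
exists (fun j => match split j with inl i => a i | inr i => a' i end).
split=> [j|]; first by case: split.
rewrite big_split_ord /= scaler_sumr; congr (_ + _); apply: eq_bigr => j _.
  by rewrite -/(unsplit (inl j)) unsplitK scalerA.
by rewrite -/(unsplit (inr j)) unsplitK.
Qed.

End Span.

Section VSpan.
Variables (k : fieldType) (V : vectType k).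

Lemma vspan_exists (A : V -> Prop) :
  exists U : {vspace V}, forall u, u \in U <-> lspan A u.
Proof.
pose P m := `[< exists s : seq V,
                  (forall u, u \in s -> A u) /\ \dim <<s>> = m >].
have exP : exists m, P m.
  by exists 0; apply/asboolP; exists [::]; rewrite span_nil dimv0.
have bdP m : P m -> (m <= \dim {:V})%N.
  by move=> /asboolP [s [_ <-]]; apply/dimvS/subvf.
case: (ex_maxnP exP bdP) => m /asboolP [s [As sm]] maxm.
exists <<s>>%VS => u; split.
  move=> us; exists (size s), (fun j => coord (in_tuple s) j u).
  exists (fun j => s`_j); split; first by move=> j; exact/As/mem_nth.
  exact: (coord_span (X := in_tuple s)).
move: u; apply: lspan_sub => [|u Au].
  by split=> [|c v w vs ws]; rewrite ?mem0v // memvD // memvZ.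
have : P (\dim <<u :: s>>).
  apply/asboolP; exists (u :: s); split=> // v.
  by rewrite inE => /orP[/eqP->|/As].
move=> /maxm; rewrite -sm => le_dim.
have sub : (<<s>> <= <<u :: s>>)%VS by rewrite span_cons addvSr.
have /eqP -> : (<<s>> == <<u :: s>>)%VS by rewrite eqEdim sub.
by rewrite memv_span // mem_head.
Qed.

Definition vspan (A : V -> Prop) : {vspace V} := sval (cid (vspan_exists A)).

Lemma mem_vspan (A : V -> Prop) u : u \in vspan A <-> lspan A u.
Proof. exact: (svalP (cid (vspan_exists A))). Qed.

Lemma mem_vspan_submodule (P : V -> Prop) u :
  submodule_pred P -> u \in vspan P <-> P u.
Proof.
move=> sP; rewrite mem_vspan; split; last exact: lspan_gen.
by move: u; apply: lspan_sub.
Qed.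

(** The quotient V/B is realised on the complement [B^C], the canonical
    projection being the projection onto [B^C] with kernel B. *)
Definition quo_map (B : {vspace V}) : 'End(V) := daddv_pi (B^C)%VS B.

Definition quov (A B : {vspace V}) : {vspace V} := (quo_map B @: A)%VS.

Lemma lker_quo_map (B : {vspace V}) : lker (quo_map B) = B.
Proof.
have CB : (B^C :&: B = 0)%VS by rewrite capvC capv_compl.
have eq_u u : u = quo_map B u + daddv_pi B (B^C)%VS u.
  by rewrite /quo_map daddv_pi_add // addvC addv_complf memvf.
apply/vspaceP => u; rewrite memv_ker; apply/eqP/idP => [u0|uB].
  by rewrite (eq_u u) u0 add0r memv_pi.
have : quo_map B u \in (B^C :&: B)%VS.
  rewrite memv_cap memv_pi -(addrK (daddv_pi B (B^C)%VS u) (quo_map B u)) -eq_u.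
  by rewrite memvB // memv_pi.
by rewrite CB memv0 => /eqP.
Qed.

Lemma dim_quov (A B : {vspace V}) :
  (B <= A)%VS -> \dim (quov A B) = (\dim A - \dim B)%N.
Proof.
move=> BA; rewrite -(limg_ker_dim (quo_map B) A) lker_quo_map.
by rewrite (capv_idPr BA) addKn.
Qed.

End VSpan.

HB.mixin Record Lmodule_isLie (k : fieldType) L of GRing.Lmodule k L := {
  lie : L -> L -> L;
  lie_linearl : forall y, linear (lie ^~ y);
  lie_linearr : forall x, linear (lie x);
  liexx : forall x, lie x x = 0;
  lie_jacobi : forall x y z,
    lie x (lie y z) + lie y (lie z x) + lie z (lie x y) = 0
}.

#[short(type="lieAlgType")]
HB.structure Definition LieAlgebra (k : fieldType) :=
  {L of Lmodule_isLie k L & GRing.Lmodule k L}.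

#[short(type="finLieAlgType")]
HB.structure Definition FinLieAlgebra (k : fieldType) :=
  {L of Lmodule_isLie k L & Vector k L}.

Definition lie_morph (k : fieldType) (L1 L2 : lieAlgType k) (f : L1 -> L2) :=
  forall x y, f (lie x y) = lie (f x) (f y).

Section LowerCentralSeries.
Variable k : fieldType.

Definition lie_span (L : lieAlgType k) (A B : L -> Prop) : L -> Prop :=
  lspan (fun u => exists a b, [/\ A a, B b & u = lie a b]).

(** Indexed from 1 as usual; the value at 0 is a dummy. *)
Fixpoint lcs (L : lieAlgType k) (i : nat) : L -> Prop :=
  match i with
  | 0 | 1 => fun=> True
  | j.+1 => lie_span (fun=> True) (@lcs L j)
  end.

Definition brv (L : finLieAlgType k) (A B : {vspace L}) : {vspace L} :=
  vspan (fun u => exists a b, [/\ a \in A, b \in B & u = lie a b]).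

Definition lcsv (L : finLieAlgType k) (i : nat) : {vspace L} := vspan (@lcs L i).

Lemma lcs_submodule (L : lieAlgType k) i : submodule_pred (@lcs L i).
Proof. by case: i => [|[|i]] //; apply: lspan_submodule. Qed.

Lemma mem_lcsv (L : finLieAlgType k) i (u : L) : u \in lcsv L i <-> lcs i u.
Proof. exact/mem_vspan_submodule/lcs_submodule. Qed.

Definition nilpotent_step (L : finLieAlgType k) (p : nat) : Prop :=
  [/\ (0 < p)%N, lcsv L p <> 0%VS & lcsv L p.+1 = 0%VS].

End LowerCentralSeries.

Section Free.
Variable k : fieldType.

Definition free_lie (n : nat) (F : lieAlgType k) (x : 'I_n -> F) : Prop :=
  forall (L : lieAlgType k) (y : 'I_n -> L),
    (exists f : {linear F -> L}, lie_morph f /\ forall j, f (x j) = y j) /\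
    (forall f1 f2 : {linear F -> L}, lie_morph f1 -> lie_morph f2 ->
       (forall j, f1 (x j) = y j) -> (forall j, f2 (x j) = y j) -> f1 =1 f2).

Inductive lie_monomial (n : nat) (F : lieAlgType k) (x : 'I_n -> F) :
    nat -> F -> Prop :=
| lie_monomial_gen j : lie_monomial x 1 (x j)
| lie_monomial_lie d e u v :
    lie_monomial x d u -> lie_monomial x e v -> lie_monomial x (d + e) (lie u v).

Definition homog (n : nat) (F : lieAlgType k) (x : 'I_n -> F) (d : nat) :
    F -> Prop :=
  lspan (lie_monomial x d).

(** [q : F -> Fr] presents Fr as the quotient F / F^(r+1). *)
Definition nilpotent_quotient (F : lieAlgType k) (r : nat)
    (Fr : finLieAlgType k) (q : {linear F -> Fr}) : Prop :=
  [/\ lie_morph q,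
      forall v, exists u, q u = v
    & forall u, q u = 0 <-> lcs r.+1 u].

(** H_d(n) sits in Fp (1 <= d <= p) and in Fp1 (1 <= d <= p+1) as the image of
    [homog x d] under the quotient maps; i is the identity on it. *)
Definition canonical_inclusion (n : nat) (F : lieAlgType k) (x : 'I_n -> F)
    (p : nat) (Fp Fp1 : finLieAlgType k)
    (qp : {linear F -> Fp}) (qp1 : {linear F -> Fp1}) (i : 'Hom(Fp, Fp1)) :=
  forall d u, (1 <= d <= p)%N -> homog x d u -> i (qp u) = qp1 u.

Definition free_nilpotent_extension (Fp g : finLieAlgType k)
    (pi : 'Hom(Fp, g)) (nn : {vspace Fp}) : Prop :=
  [/\ lie_morph pi,
      limg pi = fullv,
      lker pi = nn
    & (nn <= brv fullv fullv)%VS].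

End Free.

Record lieModule (k : fieldType) (g : lieAlgType k) (M : lmodType k) := LieModule {
  lact :> g -> M -> M;
  lact_linearl : forall m, linear (lact ^~ m);
  lact_linearr : forall x, linear (lact x);
  lact_lie : forall x y m,
    lact (lie x y) m = lact x (lact y m) - lact y (lact x m)
}.

Section TrivialModule.
Variables (k : fieldType) (g : lieAlgType k).

Let act0 : g -> k^o -> k^o := fun _ _ => 0.

Fact act0_linearl m : linear (act0 ^~ m).
Proof. by move=> c x y; rewrite /act0 scaler0 addr0. Qed.

Fact act0_linearr x : linear (act0 x).
Proof. by move=> c m m'; rewrite /act0 scaler0 addr0. Qed.

Fact act0_lie x y m : act0 (lie x y) m = act0 x (act0 y m) - act0 y (act0 x m).
Proof. by rewrite /act0 subr0. Qed.

Definition trivial_module : lieModule g k^o :=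
  LieModule act0_linearl act0_linearr act0_lie.

End TrivialModule.

Section Cohomology.
Variables (k : fieldType) (g : finLieAlgType k) (M : vectType k).
Variable X : lieModule g M.

(** A 2-cochain Lambda^2 g -> M is an alternating bilinear map, stored in
    curried form: [f x y] is f(x /\ y). *)
Local Notation bilin := 'Hom(g, 'Hom(g, M)).

Definition cocycle2 (f : bilin) : Prop :=
  (forall x, f x x = 0) /\
  (forall x y z,
     X x (f y z) - X y (f x z) + X z (f x y)
     - f (lie x y) z + f (lie x z) y - f (lie y z) x = 0).

Definition coboundary2 (f : bilin) : Prop :=
  exists a : 'Hom(g, M),
    forall x y, f x y = X x (a y) - X y (a x) - a (lie x y).

Definition Z2 : {vspace bilin} := vspan cocycle2.
Definition B2 : {vspace bilin} := vspan coboundary2.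
Definition H2 : {vspace bilin} := quov Z2 B2.

(** [mfil i] is M_i for i >= 0, and [mfilz] extends it by 0 to all integers. *)
Fixpoint mfil (i : nat) : M -> Prop :=
  match i with
  | 0 => fun m => m = 0
  | j.+1 => fun m => forall x : g, mfil j (X x m)
  end.

Definition mfilz (i : int) : M -> Prop :=
  match i with
  | Posz j => mfil j
  | Negz _ => mfil 0
  end.

Definition cocycle2_fil (r : nat) (f : bilin) : Prop :=
  cocycle2 f /\
  forall (i j : nat) (x y : g), (0 < i)%N -> (0 < j)%N ->
    lcs i x -> lcs j y -> mfilz (r%:Z - i%:Z - j%:Z + 1) (f x y).

Definition FH2 (r : nat) : {vspace bilin} :=
  quov (vspan (cocycle2_fil r)) B2.

Lemma lact0 x : X x 0 = 0.
Proof.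
by have := lact_linearr X x (-1) 0 0; rewrite scaleN1r oppr0 add0r scaleN1r addNr.
Qed.

Lemma lact0l m : X 0 m = 0.
Proof.
by have := lact_linearl X m (-1) 0 0; rewrite scaleN1r oppr0 add0r scaleN1r addNr.
Qed.

Lemma lactD x m m' : X x (m + m') = X x m + X x m'.
Proof. by have := lact_linearr X x 1 m m'; rewrite !scale1r. Qed.

Lemma lactZ x c m : X x (c *: m) = c *: X x m.
Proof. by have := lact_linearr X x c m 0; rewrite !addr0 lact0 addr0. Qed.

Lemma lactB x m m' : X x (m - m') = X x m - X x m'.
Proof. by rewrite lactD -scaleN1r lactZ scaleN1r. Qed.

Lemma mfil_submodule i : submodule_pred (mfil i).
Proof.
elim: i => [|i [P0 PD]] /=.
  by split=> // c u v -> ->; rewrite scaler0 addr0.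
split=> [x|c u v Pu Pv x]; first by rewrite lact0.
by rewrite lact_linearr; apply: PD.
Qed.

Lemma mfilz_submodule i : submodule_pred (mfilz i).
Proof. by case: i => i; apply: mfil_submodule. Qed.

Lemma bilin0E x y : (0 : bilin) x y = 0.
Proof. by rewrite !zero_lfunE. Qed.

Lemma bilinDE c (u v : bilin) x y : (c *: u + v) x y = c *: u x y + v x y.
Proof. by rewrite !(add_lfunE, scale_lfunE). Qed.

Lemma cocycle2_submodule : submodule_pred cocycle2.
Proof.
split.
  by split=> [x|x y z]; rewrite !bilin0E // !lact0 !(subr0, addr0).
move=> c u v [ua uZ] [va vZ]; split=> [x|x y z].
  by rewrite bilinDE ua va scaler0 addr0.
rewrite !bilinDE !lactD !lactZ !opprD -!scalerN.
have := congr2 +%R (congr1 ( *:%R c) (uZ x y z)) (vZ x y z).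
rewrite scaler0 addr0 !scalerDr => e; rewrite -[RHS]e.
by do 5 (rewrite [RHS]addrACA; congr (_ + _)).
Qed.

Lemma coboundary2_submodule : submodule_pred coboundary2.
Proof.
split.
  by exists 0 => x y; rewrite bilin0E !zero_lfunE !lact0 !subr0.
move=> c u v [a ua] [b vb]; exists (c *: a + b) => x y.
rewrite bilinDE ua vb !(add_lfunE, scale_lfunE).
rewrite !lactD !lactZ !opprD -!scalerN !scalerDr.
by do 2 (rewrite [LHS]addrACA; congr (_ + _)).
Qed.

Lemma cocycle2_fil_submodule r : submodule_pred (cocycle2_fil r).
Proof.
have [Z0 ZD] := cocycle2_submodule.
split=> [|c u v [uZ uF] [vZ vF]]; split=> //.
- by move=> i j x y *; rewrite bilin0E; have [] := mfilz_submodule (r%:Z - i%:Z - j%:Z + 1).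
- exact: ZD.
move=> i j x y i0 j0 xi yj; rewrite bilinDE.
have [_ mD] := mfilz_submodule (r%:Z - i%:Z - j%:Z + 1).
by apply: mD; [apply: uF | apply: vF].
Qed.

Lemma mem_Z2 f : f \in Z2 <-> cocycle2 f.
Proof. exact/mem_vspan_submodule/cocycle2_submodule. Qed.

Lemma mem_B2 f : f \in B2 <-> coboundary2 f.
Proof. exact/mem_vspan_submodule/coboundary2_submodule. Qed.

Lemma mem_FH2 r w :
  w \in FH2 r <-> exists2 f, cocycle2_fil r f & w = quo_map B2 f.
Proof.
have mem f := mem_vspan_submodule f (cocycle2_fil_submodule r).
split; first by move=> /memv_imgP [f /mem]; exists f.
by move=> [f /mem fF ->]; apply: memv_img.
Qed.

Lemma lieC (x y : g) : lie x y = - lie y x.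
Proof.
have lieDl (u v w : g) : lie (u + v) w = lie u w + lie v w.
  by have := lie_linearl w 1 u v; rewrite !scale1r.
have lieDr (u v w : g) : lie w (u + v) = lie w u + lie w v.
  by have := lie_linearr w 1 u v; rewrite !scale1r.
apply/eqP; rewrite -addr_eq0.
have := liexx (x + y); rewrite lieDl !lieDr !liexx add0r addr0 => ->.
by rewrite eqxx.
Qed.

Lemma coboundary2_cocycle2 f : coboundary2 f -> cocycle2 f.
Proof.
move=> [a fa]; split=> [x|x y z].
  by rewrite fa liexx linear0 subrr subr0.
have jac : a (lie (lie x y) z) = a (lie (lie x z) y) - a (lie (lie y z) x).
  rewrite -raddfB /=; congr (a _).
  have := lie_jacobi x y z.
  have lieNr (u v : g) : lie u (- v) = - lie u v.
    have := lie_linearr u (-1) v 0; rewrite !scaleN1r addr0 => ->.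
    have := lie_linearr u (-1) 0 0.
    by rewrite !scaleN1r oppr0 add0r addNr => ->; rewrite addr0.
  rewrite (lieC z x) lieNr (lieC (lie x y)) (lieC (lie x z)) (lieC (lie y z)).
  by rewrite opprK [- _ + _]addrC => /eqP; rewrite addr_eq0 => /eqP <-.
rewrite !fa jac !lactB !lact_lie !opprD !opprK !addrA.
rewrite [LHS](ACl (1*10*2*15*3*21*4*11*5*19*6*17*7*16*8*20*9*12*13*18*14*22)) /=.
by rewrite !(subrr, addNr, add0r).
Qed.

Lemma B2_sub_Z2 : (B2 <= Z2)%VS.
Proof. by apply/subvP => f /mem_B2 /coboundary2_cocycle2 /mem_Z2. Qed.

Lemma dim_H2 : \dim H2 = (\dim Z2 - \dim B2)%N.
Proof. exact/dim_quov/B2_sub_Z2. Qed.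

End Cohomology.

Lemma mfil_trivial (k : fieldType) (g : finLieAlgType k) i (m : k^o) :
  (0 < i)%N -> mfil (trivial_module g) i m.
Proof. by case: i => // i _ x; have [] := mfil_submodule (trivial_module g) i. Qed.

Definition betti2 (k : fieldType) (h : finLieAlgType k) : nat :=
  \dim (H2 (trivial_module h)).

(* Main.v *)
Require Import Defs.
From HB Require Import structures.
From mathcomp Require Import all_boot all_order all_algebra.
From mathcomp Require Import boolp zify.

Import GRing.Theory.
Local Open Scope ring_scope.

Set Implicit Arguments.
Unset Strict Implicit.

(** The theorem is a Hopf formula, obtained from the low-degree part of the
    inflation-restriction sequence of a surjection [pi : L -> h] with kernel n
    inside [L, L].  Over trivial coefficients,

      0 -> Hom(n/[L, n], k) -> H^2(h) -> H^2(L)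

    is exact: a cocycle on h whose inflation to L is the coboundary of a
    functional a has a vanishing on [L, n], and is determined by the
    restriction of a to [L, L].  Counting annihilators of [L, n] and of [L, L]
    gives dim n - dim [L, n] for the kernel of inflation
    ([dim_inflation_kernel_quo]).

    It remains to choose L so that this kernel is the space to be measured.
    A cocycle f on h defines a central extension of h by k.  When L is the free
    r-step nilpotent Lie algebra and this extension E satisfies E^(r+1) = 0,
    freeness lifts [pi] to a morphism from L to E, and its k-component is a
    functional making the inflation of f a coboundary
    ([inflation_trivial_free]).  This is used twice for the p-step nilpotent g.

    - If f lies in the filtration step F_p, then f vanishes on g x g^p, so
      E^(p+1) = 0 and L = f_{n,p} works.  Conversely, if f(pi u, pi v) =
      a [u, v] on f_{n,p}, then f kills g^i x g^j for i + j > p, since lifts to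
      the lower central series of f_{n,p} already commute.  Hence the cocycles
      of F_p are exactly those with trivial inflation ([dim_FH2]).

    - For arbitrary f one still has E^(p+2) = 0, so with L = f_{n,p+1} every
      cocycle has trivial inflation ([dim_H2_nilpotent]), and H^2(g) has
      dimension dim n1 - dim [L, n1] for n1 the preimage of n in f_{n,p+1}.
      The same applies to the truncation f_{n,p+1} -> f_{n,p}, whose kernel is
      the central ideal f_{n,p+1}^(p+1); so b_2(f_{n,p}) is the dimension of
      that ideal ([betti2_truncation]).

    Since the free Lie algebra is spanned by monomials, i is a section of the
    truncation, so n1 is the sum of i(n) and the central ideal, whence
    [L, n1] = [i(n), L].  The truncation maps n1 onto n and [L, n1] onto
    [f_{n,p}, n]; comparing dimensions gives the second formula. *)

(** * Brackets and the lower central series *)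

Section LieAlgebraTheory.
Variables (k : fieldType) (L : lieAlgType k).
Implicit Types x y z u v : L.

Lemma lieDl u v z : lie (u + v) z = lie u z + lie v z.
Proof. by have := lie_linearl z 1 u v; rewrite !scale1r. Qed.

Lemma lieDr u v z : lie z (u + v) = lie z u + lie z v.
Proof. by have := lie_linearr z 1 u v; rewrite !scale1r. Qed.

Lemma lie0r z : lie z 0 = 0.
Proof. by apply: (addIr (lie z 0)); rewrite -lieDr !add0r. Qed.

Lemma lie0l z : lie 0 z = 0.
Proof. by apply: (addIr (lie 0 z)); rewrite -lieDl !add0r. Qed.

Lemma lieNr u z : lie z (- u) = - lie z u.
Proof. by apply: (addIr (lie z u)); rewrite -lieDr !addNr lie0r. Qed.

Lemma lieNl u z : lie (- u) z = - lie u z.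
Proof. by apply: (addIr (lie u z)); rewrite -lieDl !addNr lie0l. Qed.

Lemma lie_anti x y : lie x y = - lie y x.
Proof.
apply/eqP; rewrite -addr_eq0; have := liexx (x + y).
by rewrite lieDl !lieDr !liexx add0r addr0 => ->; rewrite eqxx.
Qed.

Lemma lie_lie x y z : lie (lie x y) z = lie x (lie y z) - lie y (lie x z).
Proof.
have /eqP := lie_jacobi x y z.
rewrite addr_eq0 (lie_anti z (lie x y)) opprK => /eqP <-.
by rewrite (lie_anti z x) lieNr.
Qed.

Lemma lspan_lie_sub (A B P : L -> Prop) : submodule_pred P ->
  (forall u v, A u -> B v -> P (lie u v)) ->
  forall u v, lspan A u -> lspan B v -> P (lie u v).
Proof.
move=> [P0 PD] AB u v Au Bv; move: u Au; apply: lspan_sub => [|u Au].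
  split=> [|c a b Pa Pb]; first by rewrite lie0l.
  by rewrite lie_linearl; apply: PD.
move: v Bv; apply: lspan_sub => [|v Bv]; last exact: AB.
split=> [|c a b Pa Pb]; first by rewrite lie0r.
by rewrite lie_linearr; apply: PD.
Qed.

Lemma lcsS j u v : (0 < j)%N -> lcs j v -> lcs j.+1 (lie u v).
Proof. by case: j => // j _ vj; apply: lspan_gen; exists u, v. Qed.

Lemma submoduleB (P : L -> Prop) u v :
  submodule_pred P -> P u -> P v -> P (u - v).
Proof. by move=> [_ PD] Pu Pv; rewrite addrC -scaleN1r; apply: PD. Qed.

(** The Jacobi identity trades a bracket nested on the left for two nested on
    the right, which lowers the first index. *)
Lemma lie_lcs i j u v :
  (0 < i)%N -> (0 < j)%N -> lcs i u -> lcs j v -> lcs (i + j) (lie u v).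
Proof.
case: i => // i _; elim: i j u v => [|i IH] j u v j0.
  by move=> _ vj; apply: lcsS.
move=> ui vj; move: u ui; apply: lspan_sub => [|_ [a [b [_ bi ->]]]].
  have [P0 PD] := lcs_submodule L (i.+2 + j).
  split=> [|c a b Pa Pb]; first by rewrite lie0l.
  by rewrite lie_linearl; apply: PD.
rewrite lie_lie; apply: submoduleB; first exact: lcs_submodule.
  by apply: lcsS => //; apply: IH.
by rewrite addSnnS; apply: IH => //; apply: lcsS.
Qed.

Lemma lcs_pred j u : lcs j.+1 u -> lcs j u.
Proof.
elim: j u => [|[|j] IH] // u; move: u.
apply: lspan_sub => [|_ [a [b [_ bj ->]]]]; first exact: lcs_submodule.
by apply: lcsS => //; apply: IH.
Qed.

Lemma lcs_anti i j u : (i <= j)%N -> lcs j u -> lcs i u.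
Proof.
move=> /subnK <-; elim: (j - i)%N => // m IH.
by rewrite addSn => /lcs_pred /IH.
Qed.

End LieAlgebraTheory.

(** * Lower central series under morphisms *)

Section Morphisms.
Variables (k : fieldType) (L1 L2 : lieAlgType k) (phi : {linear L1 -> L2}).
Hypothesis phiM : lie_morph phi.

Lemma lcs_morph i u : lcs i u -> lcs i (phi u).
Proof.
elim: i u => // -[//|i] IH; apply: lspan_sub => [|_ [a [b [_ bi ->]]]].
  have [P0 PD] := lcs_submodule L2 i.+2.
  split=> [|c a b Pa Pb]; first by rewrite linear0.
  by rewrite linearP; apply: PD.
by rewrite phiM; apply: lcsS => //; apply: IH.
Qed.

Lemma lcs_lift i v : (forall w, exists u, phi u = w) ->
  lcs i v -> exists2 u, lcs i u & phi u = v.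
Proof.
move=> phi_surj; elim: i v => [|[|i] IH] v.
- by have [u <-] := phi_surj v; exists u.
- by have [u <-] := phi_surj v; exists u.
have [S0 SD] := lcs_submodule L1 i.+2.
move: v; apply: lspan_sub => [|_ [a [b [_ bi ->]]]].
  split=> [|c _ _ [u ui <-] [v vi <-]]; first by exists 0; rewrite ?linear0.
  by exists (c *: u + v); rewrite ?linearP //; apply: SD.
have [u <-] := phi_surj a; have [v vi <-] := IH _ bi.
by exists (lie u v); rewrite ?phiM //; apply: lcsS.
Qed.

End Morphisms.

(** * Linear and bilinear maps defined by their values *)

Section LinearExistence.
Variable k : fieldType.

Lemma lfun_ex (V W : vectType k) (h : V -> W) :
  linear h -> exists r : 'Hom(V, W), r =1 h.
Proof.
move=> h_lin.
pose H := GRing.isLinear.Build k V W _ h h_lin.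
pose l : {linear V -> W} := HB.pack h H.
by exists (linfun l) => v; rewrite lfunE.
Qed.

Lemma bilin_ex (V W : vectType k) (b : V -> V -> W) :
    (forall x, linear (b x)) -> (forall y, linear (b ^~ y)) ->
  exists f : 'Hom(V, 'Hom(V, W)), forall x y, f x y = b x y.
Proof.
move=> bl br; have [h hE] := choice (fun x => lfun_ex (bl x)).
have h_lin : linear h.
  by move=> c u v; apply/lfunP => y; rewrite add_lfunE scale_lfunE !hE br.
by have [f fE] := lfun_ex h_lin; exists f => x y; rewrite fE hE.
Qed.

Lemma factor_through_surj (F : lmodType k) (V W : vectType k)
    (q : {linear F -> V}) (h : {linear F -> W}) :
    (forall v, exists u, q u = v) -> (forall u, q u = 0 -> h u = 0) ->
  exists r : 'Hom(V, W), forall u, r (q u) = h u.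
Proof.
move=> /choice [s sK] qh.
have eq_h u v : q u = q v -> h u = h v.
  by move=> e; apply/eqP; rewrite -subr_eq0 -linearB qh // linearB e subrr.
have hs_lin : linear (h \o s).
  by move=> c u v; rewrite /= -linearP; apply: eq_h; rewrite linearP !sK.
by have [r rE] := lfun_ex hs_lin; exists r => u; rewrite rE /=; apply: eq_h.
Qed.

Lemma surj_lfun (V W : vectType k) (phi : 'Hom(V, W)) :
  limg phi = fullv -> forall w, exists u, phi u = w.
Proof.
move=> phi_surj w; have : w \in limg phi by rewrite phi_surj memvf.
by move=> /memv_imgP [u _ ->]; exists u.
Qed.

End LinearExistence.

(** * Annihilators in the dual space *)

Section Annihilator.
Variables (k : fieldType) (V : vectType k).

Definition annihilator (U : {vspace V}) : {vspace 'Hom(V, k^o)} :=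
  vspan (fun a : 'Hom(V, k^o) => forall u, u \in U -> a u = 0).

Lemma mem_annihilator U (a : 'Hom(V, k^o)) :
  a \in annihilator U <-> forall u, u \in U -> a u = 0.
Proof.
apply: mem_vspan_submodule; split=> /= [u _|c f h f0 h0 u uU].
  by rewrite zero_lfunE.
by rewrite add_lfunE scale_lfunE f0 // h0 // scaler0 addr0.
Qed.

(** Restriction of functionals from V to U is surjective, with kernel the
    annihilator. *)
Lemma dim_annihilator U : (\dim (annihilator U) + \dim U = \dim {:V})%N.
Proof.
pose res (a : 'Hom(V, k^o)) : 'Hom(subvs_of U, k^o) := (a \o linfun vsval)%VF.
have [r rE] : exists r : 'Hom('Hom(V, k^o), 'Hom(subvs_of U, k^o)), r =1 res.
  apply: lfun_ex => c a b; apply/lfunP => u.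
  by rewrite !(comp_lfunE, add_lfunE, scale_lfunE).
have kerE : lker r = annihilator U.
  apply/vspaceP => a; rewrite memv_ker rE; apply/eqP/idP => [a0|].
    apply/mem_annihilator => u uU; have /lfunP /(_ (vsproj U u)) := a0.
    by rewrite comp_lfunE lfunE /= vsprojK // zero_lfunE.
  move=> /mem_annihilator a0; apply/lfunP => u.
  by rewrite comp_lfunE lfunE zero_lfunE; apply: a0; apply: subvsP.
have imgE : limg r = fullv.
  apply/vspaceP => b; rewrite memvf; apply/memv_imgP.
  exists (b \o linfun (vsproj U))%VF; rewrite ?memvf // rE; apply/lfunP => u.
  by rewrite !comp_lfunE !lfunE /= vsvalK.
have dim_dual (W : vectType k) : dim 'Hom(W, k^o) = dim W by exact: muln1.
have := limg_ker_dim r fullv; rewrite capfv kerE imgE !dimvf !dim_dual.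
by move=> <-; rewrite -(dimvf (subvs_of U)) dimvf.
Qed.

End Annihilator.

(** * Products of subspaces *)

Section Brackets.
Variable k : fieldType.

Lemma mem_brv (L : finLieAlgType k) (A B : {vspace L}) u v :
  u \in A -> v \in B -> lie u v \in brv A B.
Proof. by move=> uA vB; apply/mem_vspan/lspan_gen; exists u, v. Qed.

Lemma brv_sub (L : finLieAlgType k) (A B C : {vspace L}) :
  (forall u v, u \in A -> v \in B -> lie u v \in C) -> (brv A B <= C)%VS.
Proof.
move=> ABC; apply/subvP => w /mem_vspan; move: w.
apply: lspan_sub => [|_ [a [b [aA bB ->]]]]; last exact: ABC.
by split=> [|c u v uC vC]; rewrite ?mem0v // memvD // memvZ.
Qed.

Lemma limg_brv (L1 L2 : finLieAlgType k) (phi : 'Hom(L1, L2))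
    (A B : {vspace L1}) :
  lie_morph phi -> (phi @: brv A B)%VS = brv (phi @: A)%VS (phi @: B)%VS.
Proof.
move=> phiM; apply/eqP; rewrite eqEsubv; apply/andP; split.
  apply/subvP => _ /memv_imgP [w wAB ->]; rewrite memv_preim.
  move: w wAB; apply/subvP/brv_sub => u v uA vB.
  by rewrite -memv_preim phiM; apply: mem_brv; apply: memv_img.
apply: brv_sub => _ _ /memv_imgP [u uA ->] /memv_imgP [v vB ->].
by rewrite -phiM; apply/memv_img/mem_brv.
Qed.

End Brackets.

(** * The kernel of inflation *)

Section InflationRestriction.
Variable k : fieldType.

(** The pullback of f along [pi] is, up to the sign of a, the coboundary of a
    functional on L. *)
Definition inflation_trivial (L h : finLieAlgType k) (pi : 'Hom(L, h))
    (f : 'Hom(h, 'Hom(h, k^o))) : Prop :=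
  exists a : 'Hom(L, k^o), forall u v, f (pi u) (pi v) = a (lie u v).

Definition inflation_kernel (L h : finLieAlgType k) (pi : 'Hom(L, h)) :=
  vspan (inflation_trivial pi).

Lemma mem_inflation_kernel (L h : finLieAlgType k) (pi : 'Hom(L, h)) f :
  f \in inflation_kernel pi <-> inflation_trivial pi f.
Proof.
apply: mem_vspan_submodule; split=> [|c f1 f2 [a1 fa1] [a2 fa2]].
  by exists 0 => u v; rewrite !zero_lfunE.
by exists (c *: a1 + a2) => u v; rewrite !(add_lfunE, scale_lfunE) fa1 fa2.
Qed.

Section Surjection.
Variables (L h : finLieAlgType k) (pi : 'Hom(L, h)).
Hypotheses (piM : lie_morph pi) (pi_surj : limg pi = fullv).

Lemma inflation_trivial_cocycle f :
  inflation_trivial pi f -> cocycle2 (trivial_module h) f.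
Proof.
move=> [a fa]; split=> [x|x y z].
  by have [u <-] := surj_lfun pi_surj x; rewrite fa liexx linear0.
have [u <-] := surj_lfun pi_surj x; have [v <-] := surj_lfun pi_surj y.
have [w <-] := surj_lfun pi_surj z.
rewrite /= !subr0 !add0r -!piM !fa -linearN -linearD -linearB /=.
rewrite (lie_anti (lie u v)) opprK (lie_anti (lie u w)) -lieNr -(lie_anti w u).
by rewrite (lie_anti (lie v w)) opprK addrC addrA addrAC lie_jacobi linear0.
Qed.

(** Let n be the kernel of [pi].  If f(pi u, pi v) = a [u, v], then a vanishes
    on [L, n]; conversely, for a vanishing on [L, n], the form a [u, v] descends
    to h, as a [s x, s y] for any linear section s of [pi].  Two functionals
    define the same f exactly when they agree on [L, L].  So the kernel of
    inflation is the annihilator of [L, n] modulo that of [L, L]. *)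
Lemma dim_inflation_kernel :
  (\dim (inflation_kernel pi) + \dim (brv fullv (lker pi))
   = \dim (brv (fullv : {vspace L}) fullv))%N.
Proof.
pose s := (pi^-1)%VF; have sK x : pi (s x) = x.
  by rewrite limg_lfunVK // pi_surj memvf.
have [Psi PsiE] : exists Psi : 'Hom('Hom(L, k^o), 'Hom(h, 'Hom(h, k^o))),
    forall a x y, Psi a x y = a (lie (s x) (s y)).
  have /choice [psi psiE] (a : 'Hom(L, k^o)) :
      exists B : 'Hom(h, 'Hom(h, k^o)), forall x y, B x y = a (lie (s x) (s y)).
    apply: (bilin_ex (b := fun x y => a (lie (s x) (s y)))) => [x|y] c u v /=.
      by rewrite linearP lie_linearr linearP.
    by rewrite linearP lie_linearl linearP.
  have psi_lin : linear psi.
    move=> c a b; apply/lfunP => x; apply/lfunP => y.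
    by rewrite !(add_lfunE, scale_lfunE, psiE).
  by have [Psi PsiE] := lfun_ex psi_lin; exists Psi => a x y; rewrite PsiE psiE.
set A := annihilator (brv fullv (lker pi)).
(* [U, V] = [U, V - v] - [v, U - u] + [u, v] with U = s (pi u), V = s (pi v) *)
have descend a u v : a \in A -> a (lie (s (pi u)) (s (pi v))) = a (lie u v).
  move=> /mem_annihilator a0.
  have dk w : s (pi w) - w \in lker pi by rewrite memv_ker linearB /= sK subrr.
  have -> : lie (s (pi u)) (s (pi v)) = lie (s (pi u)) (s (pi v) - v)
      - lie v (s (pi u) - u) + lie u v.
    rewrite lieDr lieNr (lie_anti v) opprK lieDl lieNl.
    by rewrite addrA subrK subrK.
  rewrite linearD linearB /= (a0 (lie _ (s (pi v) - v))) ?mem_brv ?memvf //.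
  by rewrite (a0 (lie v _)) ?mem_brv ?memvf // subrr add0r.
have imgE : (Psi @: A)%VS = inflation_kernel pi.
  apply/vspaceP => f; apply/memv_imgP/idP => [[a aA ->]|].
    by apply/mem_inflation_kernel; exists a => u v; rewrite PsiE descend.
  move=> /mem_inflation_kernel [a fa]; exists a.
    apply/mem_annihilator => w wn; apply/eqP.
    have -> : (a w == 0) = (w \in lker a) by rewrite memv_ker.
    move: w wn; apply/subvP/brv_sub => u v _; rewrite !memv_ker -fa => /eqP ->.
    by rewrite linear0.
  by apply/lfunP => x; apply/lfunP => y; rewrite PsiE -fa !sK.
have kerE : (A :&: lker Psi)%VS = annihilator (brv fullv fullv).
  apply/vspaceP => a; rewrite memv_cap memv_ker.
  apply/andP/idP => [[aA /eqP a0]|/mem_annihilator a0].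
    apply/mem_annihilator => w wn; apply/eqP.
    have -> : (a w == 0) = (w \in lker a) by rewrite memv_ker.
    move: w wn; apply/subvP/brv_sub => u v _ _; rewrite memv_ker -descend //.
    by rewrite -PsiE a0 !zero_lfunE.
  split.
    apply/mem_annihilator => u un; apply: a0; move: u un; apply/subvP.
    by apply: brv_sub => u v _ _; rewrite mem_brv ?memvf.
  apply/eqP/lfunP => x; apply/lfunP => y.
  by rewrite PsiE a0 ?zero_lfunE // mem_brv ?memvf.
apply: (@addnI (\dim (annihilator (brv (fullv : {vspace L}) fullv)))).
by rewrite addnA -kerE -imgE limg_ker_dim kerE !dim_annihilator.
Qed.

End Surjection.

(** Coboundaries are the cocycles with trivial inflation along the identity, so
    the same count computes their dimension. *)
Lemma B2_inflation_kernel (h : finLieAlgType k) :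
  B2 (trivial_module h) = inflation_kernel (\1%VF : 'End(h)).
Proof.
apply/vspaceP => f; apply/idP/idP.
  move=> /mem_B2 [a fa]; apply/mem_inflation_kernel; exists (- a) => u v.
  by rewrite !id_lfunE fa /= subrr sub0r opp_lfunE.
move=> /mem_inflation_kernel [a fa]; apply/mem_B2; exists (- a) => x y.
by rewrite /= subrr sub0r opp_lfunE opprK -fa !id_lfunE.
Qed.

Lemma dim_B2 (h : finLieAlgType k) :
  \dim (B2 (trivial_module h)) = \dim (brv (fullv : {vspace h}) fullv).
Proof.
rewrite B2_inflation_kernel -(dim_inflation_kernel (lim1g _)).
suff -> : brv fullv (lker (\1%VF : 'End(h))) = 0%VS by rewrite dimv0 addn0.
apply/eqP; rewrite -subv0; apply: brv_sub => u v _.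
by rewrite memv_ker id_lfunE => /eqP->; rewrite lie0r mem0v.
Qed.

Lemma dim_inflation_kernel_quo (L h : finLieAlgType k) (pi : 'Hom(L, h)) :
    lie_morph pi -> limg pi = fullv ->
    (lker pi <= brv (fullv : {vspace L}) fullv)%VS ->
  \dim (quov (inflation_kernel pi) (B2 (trivial_module h)))
  = \dim (quov (lker pi) (brv fullv (lker pi))).
Proof.
move=> piM pi_surj ker_sub.
have n_ideal : (brv fullv (lker pi) <= lker pi)%VS.
  apply: brv_sub => u v _; rewrite !memv_ker piM => /eqP->.
  by rewrite lie0r.
have B2K : (B2 (trivial_module h) <= inflation_kernel pi)%VS.
  apply/subvP => f /mem_B2 [a fa]; apply/mem_inflation_kernel.
  exists (- (a \o pi))%VF => u v.
  by rewrite fa /= subrr sub0r opp_lfunE comp_lfunE piM.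
rewrite !dim_quov // dim_B2.
have := dim_inflation_kernel pi_surj.
have := limg_ker_dim pi (brv fullv fullv).
by rewrite (capv_idPr ker_sub) limg_brv // pi_surj; lia.
Qed.

End InflationRestriction.

(** * The central extension attached to a cocycle *)

Section CentralExtension.
Variables (k : fieldType) (h : finLieAlgType k).
Variable f : 'Hom(h, 'Hom(h, k^o)).

(** The proof of the cocycle condition is a parameter of the type, so that the
    Jacobi identity is available to the Lie algebra structure declared on it. *)
Definition central_ext of cocycle2 (trivial_module h) f : Type := (h * k^o)%type.

Hypothesis fZ : cocycle2 (trivial_module h) f.
Local Notation E := (central_ext fZ).

HB.instance Definition _ := GRing.Lmodule.copy E (h * k^o)%type.

Definition ext_proj (e : E) : h := e.1.
Definition ext_fiber (e : E) : k^o := e.2.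
Definition ext_lie (e1 e2 : E) : E :=
  (lie (ext_proj e1) (ext_proj e2), f (ext_proj e1) (ext_proj e2)).

Fact ext_proj_linear : linear ext_proj. Proof. by []. Qed.
Fact ext_fiber_linear : linear ext_fiber. Proof. by []. Qed.

HB.instance Definition _ :=
  GRing.isLinear.Build k E h _ ext_proj ext_proj_linear.
HB.instance Definition _ :=
  GRing.isLinear.Build k E k^o _ ext_fiber ext_fiber_linear.

Lemma ext_eq (e1 e2 : E) :
  ext_proj e1 = ext_proj e2 -> ext_fiber e1 = ext_fiber e2 -> e1 = e2.
Proof. by case: e1 e2 => [? ?] [? ?]; rewrite /ext_proj /ext_fiber /= => -> ->. Qed.

Lemma cocycle2_anti x y : f x y = - f y x.
Proof.
have [fxx _] := fZ; apply/eqP; rewrite -addr_eq0; have := fxx (x + y).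
by rewrite (linearD f) add_lfunE !linearD /= !fxx add0r addr0 addrC => ->.
Qed.

Fact ext_lie_linearl e : linear (ext_lie ^~ e).
Proof.
move=> c u v; apply: ext_eq; rewrite linearP /=; first exact: lie_linearl.
by rewrite /ext_lie /ext_fiber /= !linearP add_lfunE scale_lfunE.
Qed.

Fact ext_lie_linearr e : linear (ext_lie e).
Proof.
move=> c u v; apply: ext_eq; rewrite linearP /=; first exact: lie_linearr.
by rewrite /ext_lie /ext_fiber /= !linearP.
Qed.

Fact ext_liexx e : ext_lie e e = 0.
Proof. by have [fxx _] := fZ; apply: ext_eq; [apply: liexx | apply: fxx]. Qed.

Fact ext_lie_jacobi u v w :
  ext_lie u (ext_lie v w) + ext_lie v (ext_lie w u) + ext_lie w (ext_lie u v)
  = 0.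
Proof.
apply: ext_eq; first exact: lie_jacobi.
have [_ /(_ (ext_proj u) (ext_proj v) (ext_proj w))] := fZ.
rewrite !linearD linear0 /ext_fiber /= !add0r.
move: (ext_proj u) (ext_proj v) (ext_proj w) => x y z.
rewrite (cocycle2_anti (lie x y)) opprK (cocycle2_anti (lie x z)) -linearN.
rewrite -(lie_anti z x) (cocycle2_anti (lie y z)) opprK => <-.
by rewrite [RHS]addrC addrA addrAC.
Qed.

HB.instance Definition _ := Lmodule_isLie.Build k E
  ext_lie_linearl ext_lie_linearr ext_liexx ext_lie_jacobi.

Lemma ext_proj_morph : lie_morph (ext_proj : {linear E -> h}).
Proof. by []. Qed.

End CentralExtension.

(** * Consequences of freeness *)

Section FreeNilpotent.
Variables (k : fieldType) (n : nat) (F : lieAlgType k) (x : 'I_n -> F).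
Hypothesis x_free : free_lie x.

(** Sending each generator to a lift of its image in h defines a morphism from F
    to the extension E over h.  Its k-component vanishes on F^(r+1), because that
    of E^(r+1) is zero, so it descends to a functional on L; the coboundary of
    this functional is, up to sign, the inflation of f. *)
Lemma inflation_trivial_free (r : nat) (L h : finLieAlgType k)
    (q : {linear F -> L}) (pi : 'Hom(L, h)) (f : 'Hom(h, 'Hom(h, k^o)))
    (fZ : cocycle2 (trivial_module h) f) :
    nilpotent_quotient r q -> lie_morph pi ->
    (forall e : central_ext fZ, lcs r.+1 e -> ext_fiber e = 0) ->
  inflation_trivial pi f.
Proof.
move=> [qM q_surj qK] piM E_nil.
have [[phi [phiM phi_x]] _] :=
  x_free (fun j => (pi (q (x j)), 0) : central_ext fZ).
have phi_proj u : ext_proj (phi u) = pi (q u).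
  have [_ uniq_lift] := x_free (fun j => pi (q (x j))).
  pose f1 : {linear F -> h} := @ext_proj _ _ _ fZ \o phi.
  pose f2 : {linear F -> h} := pi \o q.
  apply: (uniq_lift f1 f2) => [v w|v w|j|//] /=; rewrite ?phiM ?qM ?piM //.
  by rewrite phi_x.
pose alpha : {linear F -> k^o} := @ext_fiber _ _ _ fZ \o phi.
have [a aE] : exists a : 'Hom(L, k^o), forall u, a (q u) = alpha u.
  apply: factor_through_surj => // u /qK /(lcs_morph phiM); exact: E_nil.
exists a => u v; have [u' <-] := q_surj u; have [v' <-] := q_surj v.
by rewrite -qM aE /alpha /= phiM -!phi_proj.
Qed.

Definition monomial_span : {pred F} :=
  [pred u | `[< lspan (fun v => exists d, lie_monomial x d v) u >]].

Fact monomial_span_submod : submod_closed monomial_span.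
Proof.
have [S0 SD] := lspan_submodule (fun v => exists d, lie_monomial x d v).
split=> [|c u v /asboolP uS /asboolP vS]; first exact/asboolP.
by apply/asboolP/SD.
Qed.

HB.instance Definition _ :=
  GRing.isSubmodClosed.Build k F monomial_span monomial_span_submod.

Lemma monomial_span_lie u v :
  u \in monomial_span -> v \in monomial_span -> lie u v \in monomial_span.
Proof.
move=> /asboolP uS /asboolP vS; apply/asboolP; move: u v uS vS.
apply: lspan_lie_sub => [|u v [d ud] [e ve]]; first exact: lspan_submodule.
by apply: lspan_gen; exists (d + e)%N; apply: lie_monomial_lie.
Qed.

(** The span of the monomials as a Lie algebra in its own right, so that the
    universal property can be applied to it as a target. *)
Definition monomial_subalg : Type := {u | u \in monomial_span}.
HB.instance Definition _ := SubChoice.on monomial_subalg.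
HB.instance Definition _ := [SubChoice_isSubLmodule of monomial_subalg by <:].

Definition subalg_lie (u v : monomial_subalg) : monomial_subalg :=
  Sub (lie (val u) (val v)) (monomial_span_lie (valP u) (valP v)).

Fact subalg_lie_linearl v : linear (subalg_lie ^~ v).
Proof. by move=> c u w; apply: val_inj; rewrite /= lie_linearl. Qed.

Fact subalg_lie_linearr v : linear (subalg_lie v).
Proof. by move=> c u w; apply: val_inj; rewrite /= lie_linearr. Qed.

Fact subalg_liexx v : subalg_lie v v = 0.
Proof. by apply: val_inj; rewrite /= liexx. Qed.

Fact subalg_lie_jacobi u v w :
  subalg_lie u (subalg_lie v w) + subalg_lie v (subalg_lie w u)
  + subalg_lie w (subalg_lie u v) = 0.
Proof. by apply: val_inj; rewrite /= lie_jacobi. Qed.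

HB.instance Definition _ := Lmodule_isLie.Build k monomial_subalg
  subalg_lie_linearl subalg_lie_linearr subalg_liexx subalg_lie_jacobi.

(** The universal property retracts F onto the span of the monomials; followed by
    the inclusion, this retraction fixes the generators, so it is the identity. *)
Lemma free_lie_monomial_span u : lspan (fun v => exists d, lie_monomial x d v) u.
Proof.
have x_in j : x j \in monomial_span.
  by apply/asboolP/lspan_gen; exists 1%N; apply: lie_monomial_gen.
have [[phi [phiM phi_x]] _] := x_free (fun j => Sub (x j) (x_in j) : monomial_subalg).
have [_ uniq_lift] := x_free x.
pose f1 : {linear F -> F} := val \o phi.
pose f2 : {linear F -> F} := idfun.
suff <- : f1 u = u by apply/asboolP; exact: (valP (phi u)).
apply: (uniq_lift f1 f2) => // [v w|j] /=; first by rewrite phiM.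
by rewrite phi_x.
Qed.

Lemma lie_monomial_deg d u : lie_monomial x d u -> (0 < d)%N.
Proof. by elim=> // {}d e _ _ _ d0 _ _; rewrite ltn_addr. Qed.

Lemma lie_monomial_lcs d u : lie_monomial x d u -> lcs d u.
Proof.
elim=> // {}d e {}u v ud du ve ev.
by apply: lie_lcs => //; [apply: lie_monomial_deg ud | apply: lie_monomial_deg ve].
Qed.

End FreeNilpotent.

(** * Second cohomology through free nilpotent Lie algebras *)

Section NilpotentExtensions.
Variables (k : fieldType) (n : nat) (F : lieAlgType k) (x : 'I_n -> F).
Hypothesis x_free : free_lie x.

(** The elements of E^r lie over h^r, so f, the fibre component of a bracket,
    vanishes on brackets of E with E^r. *)
Lemma ext_fiber_lcs (h : finLieAlgType k) f
    (fZ : cocycle2 (trivial_module h) f) (r : nat) :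
    (0 < r)%N -> (forall y z, lcs r z -> f y z = 0) ->
  forall e : central_ext fZ, lcs r.+1 e -> ext_fiber e = 0.
Proof.
case: r => // r _ f0 e; move: e; apply: lspan_sub => [|_ [a [b [_ br ->]]]].
  split=> [|c u v u0 v0]; first by rewrite linear0.
  by rewrite linearP /= u0 v0 scaler0 addr0.
rewrite -[LHS]/(f (ext_proj a) (ext_proj b)); apply: f0.
exact: (lcs_morph (ext_proj_morph (fZ := fZ)) (br : lcs r.+1 b)).
Qed.

Lemma nilpotent_quotient_lcs (r : nat) (L : finLieAlgType k)
    (q : {linear F -> L}) :
  nilpotent_quotient r q -> forall v : L, lcs r.+1 v -> v = 0.
Proof.
by move=> [qM q_surj qK] v /(lcs_lift qM q_surj) [u ur <-]; apply/qK.
Qed.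

Variables (r : nat) (L h : finLieAlgType k) (q : {linear F -> L}).
Variable pi : 'Hom(L, h).
Hypotheses (r_gt0 : (0 < r)%N) (qP : nilpotent_quotient r q).
Hypotheses (piM : lie_morph pi) (pi_surj : limg pi = fullv).

(** A central extension by k of h with h^r = 0 satisfies E^(r+1) = 0. *)
Lemma Z2_inflation_kernel :
  (forall y : h, lcs r y -> y = 0) ->
  Z2 (trivial_module h) = inflation_kernel pi.
Proof.
move=> h_nil; apply/vspaceP => f; apply/idP/idP.
  move=> /mem_Z2 fZ; apply/mem_inflation_kernel.
  apply: (inflation_trivial_free x_free (fZ := fZ) qP piM).
  by apply: ext_fiber_lcs => // y z /h_nil ->; rewrite linear0.
move=> /mem_inflation_kernel f_triv; apply/mem_Z2.
exact: inflation_trivial_cocycle f_triv.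
Qed.

(** For f in F_r, the condition at (1, r) is all that E^(r+1) = 0 requires.
    Conversely, if i + j > r, elements of h^i and h^j lift to L^i and L^j,
    where they commute; f, being the image of the bracket under a functional,
    vanishes on them.  If i + j <= r the filtration imposes nothing on trivial
    coefficients. *)
Lemma cocycle2_fil_inflation_trivial f :
  cocycle2_fil (trivial_module h) r f <-> inflation_trivial pi f.
Proof.
split=> [[fZ f_fil]|f_triv].
  apply: (inflation_trivial_free x_free (fZ := fZ) qP piM).
  apply: ext_fiber_lcs => // y z zr.
  have := f_fil 1 r y z isT r_gt0 I zr.
  by have -> : (r%:Z - 1%:Z - r%:Z + 1 = 0)%R by lia.
split; first exact: inflation_trivial_cocycle f_triv.
have [a fa] := f_triv => i j y z i0 j0 yi zj.
have [ij_le|ij_gt] := leqP (i + j) r.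
  have -> : (r%:Z - i%:Z - j%:Z + 1 = (r - (i + j)).+1%:Z)%R by lia.
  exact: mfil_trivial.
have [u ui <-] := lcs_lift (phi := pi) piM (surj_lfun pi_surj) yi.
have [v vj <-] := lcs_lift (phi := pi) piM (surj_lfun pi_surj) zj.
have -> : f (pi u) (pi v) = 0.
  rewrite fa (nilpotent_quotient_lcs qP (v := lie u v)) ?linear0 //.
  by apply: lcs_anti ij_gt _; apply: lie_lcs.
by have [] := mfilz_submodule (trivial_module h) (r%:Z - i%:Z - j%:Z + 1).
Qed.

Lemma dim_FH2 : (lker pi <= brv fullv fullv)%VS ->
  \dim (FH2 (trivial_module h) r) = \dim (quov (lker pi) (brv fullv (lker pi))).
Proof.
move=> ker_sub; rewrite -dim_inflation_kernel_quo //; congr (\dim (quov _ _)).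
apply/vspaceP => f; apply/idP/idP.
  move=> /(mem_vspan_submodule _ (cocycle2_fil_submodule _ _)) f_fil.
  exact/mem_inflation_kernel/cocycle2_fil_inflation_trivial.
move=> /mem_inflation_kernel/cocycle2_fil_inflation_trivial f_fil.
exact/(mem_vspan_submodule _ (cocycle2_fil_submodule _ _)).
Qed.

Lemma dim_H2_nilpotent : (lker pi <= brv fullv fullv)%VS ->
    (forall y : h, lcs r y -> y = 0) ->
  \dim (H2 (trivial_module h)) = \dim (quov (lker pi) (brv fullv (lker pi))).
Proof.
by move=> ker_sub h_nil; rewrite /H2 Z2_inflation_kernel // dim_inflation_kernel_quo.
Qed.

End NilpotentExtensions.

(** * The truncation from step p+1 to step p *)

Section Truncation.
Variables (k : fieldType) (n : nat) (F : lieAlgType k) (x : 'I_n -> F).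
Hypothesis x_free : free_lie x.
Variables (p : nat) (Lp Lp1 : finLieAlgType k).
Variables (qp : {linear F -> Lp}) (qp1 : {linear F -> Lp1}).
Hypotheses (p_gt0 : (0 < p)%N).
Hypotheses (qpP : nilpotent_quotient p qp) (qp1P : nilpotent_quotient p.+1 qp1).

Lemma truncation_ex :
  exists rho : 'Hom(Lp1, Lp), forall u, rho (qp1 u) = qp u.
Proof.
have [_ qp1_surj qp1K] := qp1P; have [_ _ qpK] := qpP.
by apply: factor_through_surj => // u /qp1K /lcs_pred /qpK.
Qed.

Variable rho : 'Hom(Lp1, Lp).
Hypothesis rhoE : forall u, rho (qp1 u) = qp u.

Lemma truncation_morph : lie_morph rho.
Proof.
have [qpM _ _] := qpP; have [qp1M qp1_surj _] := qp1P => u v.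
have [u' <-] := qp1_surj u; have [v' <-] := qp1_surj v.
by rewrite -qp1M !rhoE qpM.
Qed.

Lemma truncation_surj : limg rho = fullv.
Proof.
have [_ qp_surj _] := qpP; apply/vspaceP => v; rewrite memvf.
by have [u <-] := qp_surj v; rewrite -rhoE memv_img ?memvf.
Qed.

Lemma lker_truncation : lker rho = lcsv Lp1 p.+1.
Proof.
have [qpM _ qpK] := qpP; have [qp1M qp1_surj qp1K] := qp1P.
apply/vspaceP => u; rewrite memv_ker; apply/eqP/idP.
  have [v <-] := qp1_surj u; rewrite rhoE => /qpK v_lcs.
  by apply/mem_lcsv/lcs_morph.
move=> /mem_lcsv u_lcs; apply: (nilpotent_quotient_lcs qpP).
exact: (lcs_morph truncation_morph).
Qed.

(** It suffices to look at monomials: those of degree at most p are fixed by i,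
    and those of higher degree vanish in Lp. *)
Lemma canonical_inclusion_section (i : 'Hom(Lp, Lp1)) :
  canonical_inclusion x p qp qp1 i -> cancel i rho.
Proof.
move=> i_can v; have [_ qp_surj qpK] := qpP; have [u <-] := qp_surj v.
have := free_lie_monomial_span x_free u; move: u {v}.
apply: lspan_sub => [|u [d ud]].
  split=> [|c u v eu ev]; first by rewrite !linear0.
  by rewrite !linearP /= eu ev.
have [d_le|d_gt] := leqP d p.
  rewrite (i_can d) ?rhoE ?d_le ?(lie_monomial_deg ud) //.
  exact: lspan_gen.
suff -> : qp u = 0 by rewrite !linear0.
by apply/qpK; apply: lcs_anti d_gt _; apply: lie_monomial_lcs ud.
Qed.

Lemma lcsv_central u v : v \in lcsv Lp1 p.+1 -> lie u v = 0.
Proof.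
move=> /mem_lcsv v_lcs; apply: (nilpotent_quotient_lcs qp1P).
exact: lcsS.
Qed.

Lemma lker_truncation_sub : (lker rho <= brv fullv fullv)%VS.
Proof.
rewrite lker_truncation; apply/subvP => u /mem_lcsv u_lcs.
apply/mem_vspan; have := lcs_anti (p_gt0 : (2 <= p.+1)%N) u_lcs.
by move: u {u_lcs}; apply: lspan_sub => [|_ [a [b [_ _ ->]]]];
  [apply: lspan_submodule | apply: lspan_gen; exists a, b; rewrite !memvf].
Qed.

(** The Hopf formula for Lp itself, the kernel of the truncation being central in
    Lp1. *)
Lemma betti2_truncation : betti2 Lp = \dim (lcsv Lp1 p.+1).
Proof.
rewrite /betti2 (dim_H2_nilpotent x_free _ qp1P truncation_morph) //.
- rewrite lker_truncation dim_quov.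
    suff -> : brv fullv (lcsv Lp1 p.+1) = 0%VS by rewrite dimv0 subn0.
    apply/eqP; rewrite -subv0; apply: brv_sub => u v _ v_lcs.
    by rewrite lcsv_central // mem0v.
  by apply: brv_sub => u v _ v_lcs; rewrite lcsv_central // mem0v.
- exact: truncation_surj.
- exact: lker_truncation_sub.
exact: nilpotent_quotient_lcs qpP.
Qed.

End Truncation.

(** * The dimension formulas *)

Theorem corollary1p7 (k : fieldType) (g : finLieAlgType k) (p n : nat)
    (g_nil : nilpotent_step g p)
    (dim_n : n = \dim (quov (fullv : {vspace g}) (brv fullv fullv)))
    (f : lieAlgType k) (x : 'I_n -> f) (f_free : free_lie x)
    (fp fp1 : finLieAlgType k)
    (qp : {linear f -> fp}) (qp1 : {linear f -> fp1})
    (qpP : nilpotent_quotient p qp) (qp1P : nilpotent_quotient p.+1 qp1)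
    (pi : 'Hom(fp, g)) (nn : {vspace fp})
    (ext : free_nilpotent_extension pi nn)
    (i : 'Hom(fp, fp1)) (i_can : canonical_inclusion x p qp qp1 i) :
  \dim (FH2 (trivial_module g) p) = \dim (quov nn (brv fullv nn)) /\
  ((\dim (H2 (trivial_module g)))%:Z =
     (\dim (quov nn (brv fullv nn)))%:Z + (betti2 fp)%:Z
     - (\dim (brv (i @: nn) fullv :&: lcsv fp1 p.+1))%:Z)%R.
Proof.
have [p_gt0 _ g_lcs] := g_nil; have [piM pi_surj pi_ker nn_sub] := ext.
split; first by rewrite -pi_ker (dim_FH2 f_free p_gt0 qpP piM) ?pi_ker.
have [rho rhoE] := truncation_ex qpP qp1P.
have rhoM := truncation_morph qpP qp1P rhoE.
have rho_surj := truncation_surj qpP rhoE.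
have rho_ker := lker_truncation qpP qp1P rhoE.
have iK := canonical_inclusion_section f_free qpP rhoE i_can.
(* The presentation of g by the free (p+1)-step nilpotent Lie algebra. *)
pose pi1 := (pi \o rho)%VF.
have pi1M : lie_morph pi1 by move=> u v; rewrite !comp_lfunE rhoM piM.
have pi1_surj : limg pi1 = fullv by rewrite limg_comp rho_surj.
have mem_ker1 u : (u \in lker pi1) = (rho u \in nn).
  by rewrite -pi_ker !memv_ker comp_lfunE.
have rho_sub : (lker rho <= lker pi1)%VS.
  by apply/subvP => u; rewrite mem_ker1 memv_ker => /eqP->; rewrite mem0v.
have rho_ker1 : (rho @: lker pi1)%VS = nn.
  apply/vspaceP => v; apply/memv_imgP/idP => [[u u1 ->]|v_nn].
    by rewrite -mem_ker1.
  by exists (i v); rewrite ?iK // mem_ker1 iK.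
have ker1_sub : (lker pi1 <= brv fullv fullv)%VS.
  apply/subvP => u; rewrite mem_ker1 => /(subvP nn_sub).
  rewrite -rho_surj -limg_brv // => /memv_imgP [v v_br e].
  rewrite -(subrK v u) memvD //.
  apply: (subvP (lker_truncation_sub p_gt0 qpP qp1P rhoE)).
  by rewrite memv_ker linearB /= e subrr.
have ker1_nil (y : g) : lcs p.+1 y -> y = 0.
  by move=> /mem_lcsv; rewrite g_lcs memv0 => /eqP.
(* lker pi1 is i(nn) plus the kernel of rho, and the latter is central. *)
have brE : brv fullv (lker pi1) = brv (i @: nn)%VS fullv.
  apply/eqP; rewrite eqEsubv; apply/andP; split; apply: brv_sub => u v.
    move=> _; rewrite mem_ker1 => v_nn.
    rewrite -(subrK (i (rho v)) v) lieDr.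
    have -> : lie u (v - i (rho v)) = 0.
      by apply: (lcsv_central qp1P); rewrite -rho_ker memv_ker linearB /= iK subrr.
    by rewrite add0r lie_anti memvN mem_brv ?memvf ?memv_img.
  move=> /memv_imgP [w w_nn ->] _; rewrite lie_anti memvN.
  by rewrite mem_brv ?memvf // mem_ker1 iK.
have nn_ideal : (brv fullv nn <= nn)%VS.
  rewrite -pi_ker; apply: brv_sub => u v _; rewrite !memv_ker piM => /eqP->.
  by rewrite lie0r.
have ker1_ideal : (brv fullv (lker pi1) <= lker pi1)%VS.
  apply: brv_sub => u v _; rewrite !memv_ker pi1M => /eqP->.
  by rewrite lie0r.
(* Rank-nullity for rho on lker pi1 and on its bracket with the whole algebra. *)
have := limg_ker_dim rho (brv fullv (lker pi1)).
have := limg_ker_dim rho (lker pi1).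
rewrite limg_brv // rho_surj rho_ker1 (capv_idPr rho_sub).
rewrite (dim_H2_nilpotent f_free _ qp1P pi1M) //.
rewrite (betti2_truncation f_free p_gt0 qpP qp1P rhoE) !dim_quov //.
have := dimvS nn_ideal; have := dimvS ker1_ideal.
rewrite rho_ker brE; lia.
Qed.
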